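(* Suppose that both $2c_1-j_1c_0$ and $2c_1-j_2c_0$ are non-zero. Then for every polynomial $P(x)\in\mathbb R[x]$, the triple $(F_1(x),G_1(x),H_1(x))\in\mathbb R[x]^3$ satisfying $$2\sum_{k=1}^{n}P(k)s_{k-1}=F_1(n)s_{n+1}+G_1(n)s_n+H_1(n)\qquad\text{for all } n\in\mathbb N$$ is unique.
   Context: $\mathbb N$ denotes the positive integers. Fix $a,b\in\mathbb N$ and $c_0,c_1\in\mathbb Z$ with $(c_0,c_1)\neq(0,0)$. The generalized Fibonacci sequence $(s_n)_{n\ge0}$ is defined by $s_0=c_0$, $s_1=c_1$, and $s_{n+1}=as_n+bs_{n-1}$ for all $n\in\mathbb N$. Put $j_1=a+\sqrt{a^2+4b}$ and $j_2=a-\sqrt{a^2+4b}$. *)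

(* Defs.v *)
From mathcomp Require Import all_boot all_order all_algebra.
From mathcomp Require Import reals.
Set Implicit Arguments.
Unset Strict Implicit.
Unset Printing Implicit Defensive.
Import Order.TTheory GRing.Theory Num.Theory.
Local Open Scope ring_scope.

Fixpoint gfib (a b : nat) (c0 c1 : int) (n : nat) : int :=
  match n with
  | 0 => c0
  | m.+1 =>
      match m with
      | 0 => c1
      | k.+1 => a%:Z * gfib a b c0 c1 m + b%:Z * gfib a b c0 c1 k
      end
  end.

Definition j1 (R : realType) (a b : nat) : R :=
  a%:R + Num.sqrt (a%:R ^+ 2 + 4 * b%:R).

Definition j2 (R : realType) (a b : nat) : R :=
  a%:R - Num.sqrt (a%:R ^+ 2 + 4 * b%:R).

(* Main.v *)
(** Summing by parts, a solution with constant [H1] amounts to a solution of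
    [b F(x) + a F(x-1) - F(x-2) = 2 P(x)]; this operator acts on leading
    coefficients as multiplication by [a + b - 1 <> 0], hence is surjective.
    For uniqueness, Binet's formula [s_n = A alpha^n + B beta^n], with
    [alpha = j1/2], [beta = j2/2], and [A], [B] nonzero by the two hypotheses,
    turns the difference of two solutions into a vanishing exponential
    polynomial with the distinct nonzero bases [alpha], [beta], [1]. *)
Require Import Defs.
From mathcomp Require Import all_boot all_order all_algebra.
From mathcomp Require Import reals ring lra.
Set Implicit Arguments.
Unset Strict Implicit.
Import Order.TTheory GRing.Theory Num.Theory.
Local Open Scope ring_scope.

(** A shift preserves size and leading coefficient, so the top terms cancel. *)
Lemma size_comp_polyXaddC_sub (K : fieldType) (p : {poly K}) (c : K) :
  (size (p \Po ('X + c%:P) - p)%R <= (size p).-1)%N.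
Proof.
have szp : size (p \Po ('X + c%:P)) = size p.
  by rewrite size_comp_poly2 // size_XaddC.
have lcp : lead_coef (p \Po ('X + c%:P)) = lead_coef p.
  by rewrite lead_coef_comp ?size_XaddC // lead_coefXaddC expr1n mulr1.
apply/leq_sizeP => i; rewrite leq_eqVlt coefB => /orP[/eqP <-|lt_i].
  by move: lcp; rewrite !lead_coefE szp => ->; rewrite subrr.
have le_i : (size p <= i)%N by case: (size p) lt_i.
by rewrite !nth_default ?szp ?subrr.
Qed.

(** Induction on the size of [q]: for [p = q / c], the error [L p - q] is smaller than [q], hence of
    the form [L r], and [p - r] is a preimage of [q]. *)
Lemma leading_scale_surj (K : fieldType) (c : K) (L : {poly K} -> {poly K}) :
  c != 0 -> {morph L : p q / p - q} ->
  (forall p, (size (L p - c *: p)%R <= (size p).-1)%N) ->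
  forall q, exists p, L p = q.
Proof.
move=> c0 LB szL q; have [n] := ubnP (size q); elim: n q => // n IHn q lt_q.
have [->|q0] := eqVneq q 0; first by exists 0; rewrite -{1}(subrr 0) LB subrr.
pose p := c^-1 *: q; have cp : c *: p = q by rewrite scalerA mulfV // scale1r.
have [|r Lr] := IHn (L p - q).
  rewrite -cp (leq_ltn_trans (szL p)) // size_scale ?invr_eq0 //.
  by move: lt_q q0; rewrite -size_poly_eq0; case: (size q).
by exists (p - r); rewrite LB Lr subKr.
Qed.

Lemma poly_eq0_nat (K : numFieldType) (p : {poly K}) :
  (forall n, (0 < n)%N -> p.[n%:R] = 0) -> p = 0.
Proof.
move=> p0; apply: (@roots_geq_poly_eq0 _ p [seq i%:R | i <- iota 1 (size p)]).
- by apply/allP => _ /mapP[i + ->]; rewrite mem_iota => /andP[i0 _]; rewrite /root p0.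
- by rewrite map_inj_uniq ?iota_uniq // => i j /eqP; rewrite eqr_nat => /eqP.
- by rewrite size_map size_iota.
Qed.

(* Applying [u n |-> u n.+1 - x * u n] lowers the degree of the coefficient of
   [x ^+ n] and acts injectively on the coefficients of the other bases. *)
Lemma exp_poly_indep (K : numFieldType) (s : seq K) (P : K -> {poly K}) :
  uniq s -> 0 \notin s ->
  (forall n, (0 < n)%N -> \sum_(x <- s) (P x).[n%:R] * x ^+ n = 0) ->
  forall x, x \in s -> P x = 0.
Proof.
elim: s P => [//|x s IHs] P /= /andP[xs us].
rewrite inE negb_or => /andP[x0 s0].
(* Inner induction on the size of the coefficient of the first base; once that coefficient is 0, the
   induction on [s] takes over. *)
have [m] := ubnP (size (P x)); elim: m P => // m IHm P lt_m Psum.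
have [Px0|Px0] := eqVneq (P x) 0.
  move=> y; rewrite inE => /predU1P[-> //|]; apply: IHs => // n n0.
  by have := Psum n n0; rewrite big_cons Px0 horner0 mul0r add0r.
(* [Q y] is the coefficient of [y ^+ n] in [u n.+1 - x * u n]. *)
pose Q y := y *: (P y \Po ('X + 1%:P)) - x *: P y.
have QE y : Q y - (y - x) *: P y = y *: (P y \Po ('X + 1%:P) - P y).
  by rewrite /Q scalerBl scalerBr; ring.
have szQ y : (size (Q y - (y - x) *: P y)%R <= (size (P y)).-1)%N.
  by rewrite QE (leq_trans (size_scale_leq _ _)) ?size_comp_polyXaddC_sub.
have Q0 y : y \in x :: s -> Q y = 0.
  apply: IHm => [|n n0].
    have := szQ x; rewrite subrr scale0r subr0 => /leq_ltn_trans; apply.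
    by move: lt_m Px0; rewrite -size_poly_eq0; case: (size (P x)).
  transitivity (\sum_(y <- x :: s) (P y).[n.+1%:R] * y ^+ n.+1
                - x * \sum_(y <- x :: s) (P y).[n%:R] * y ^+ n); last first.
    by rewrite !Psum // mulr0 subr0.
  rewrite mulr_sumr -sumrB; apply: eq_bigr => z _.
  by rewrite /Q !hornerE horner_comp !hornerE -natr1 exprS /=; ring.
have Ps0 y : y \in s -> P y = 0.
  move=> ys; have yx : y - x != 0.
    by rewrite subr_eq0; apply: contraNneq xs => <-.
  (* With [Q y = 0] and [y != x], the bound says that [P y] has size at most its own predecessor, so
     [P y = 0]. *)
  have := szQ y; rewrite Q0 ?inE ?ys ?orbT // sub0r size_polyN size_scale //.
  move=> le_P; apply/eqP; rewrite -size_poly_eq0.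
  by case: (size (P y)) le_P => // k; rewrite ltnn.
move=> y; rewrite inE => /predU1P[->|/Ps0 //].
apply: poly_eq0_nat => n n0; have := Psum n n0.
rewrite big_cons big_seq big1 => [|z /Ps0 ->]; last by rewrite horner0 mul0r.
rewrite addr0 => /eqP; rewrite mulf_eq0 expf_eq0 (eq_sym x) (negbTE x0).
by rewrite andbF orbF => /eqP.
Qed.

Lemma gfibSS (a b : nat) (c0 c1 : int) n :
  gfib a b c0 c1 n.+2 = a%:Z * gfib a b c0 c1 n.+1 + b%:Z * gfib a b c0 c1 n.
Proof. by []. Qed.

(** Both sides obey the same recurrence, as [x] and [y] are the roots of [t^2 - a t - b]. The factor
    [x - y] avoids a division. *)
Lemma gfib_binet (K : fieldType) (a b : nat) (c0 c1 : int) (x y : K) :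
  x + y = a%:R -> x * y = - b%:R -> forall n,
  (x - y) * (gfib a b c0 c1 n)%:~R =
  (c1%:~R - y * c0%:~R) * x ^+ n - (c1%:~R - x * c0%:~R) * y ^+ n.
Proof.
move=> sxy pxy n.
suff [] : (x - y) * (gfib a b c0 c1 n)%:~R =
    (c1%:~R - y * c0%:~R) * x ^+ n - (c1%:~R - x * c0%:~R) * y ^+ n /\
  (x - y) * (gfib a b c0 c1 n.+1)%:~R =
    (c1%:~R - y * c0%:~R) * x ^+ n.+1 - (c1%:~R - x * c0%:~R) * y ^+ n.+1 by [].
elim: n => [|n [IH0 IH1]]; first by split; rewrite /= ?expr1 ?expr0; ring.
split=> //; rewrite gfibSS rmorphD !rmorphM /= -!pmulrn -sxy.
have -> : b%:R = - (x * y) by rewrite pxy opprK.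
rewrite mulrDr mulrCA IH1 mulrCA IH0 !exprS; ring.
Qed.

Lemma gfib_exp_poly_indep (K : numFieldType) (a b : nat) (c0 c1 : int) (x y : K)
    (F G H : {poly K}) :
  x + y = a%:R -> x * y = - b%:R -> uniq [:: x; y; 1] -> (0 < b)%N ->
  c1%:~R - x * c0%:~R != 0 -> c1%:~R - y * c0%:~R != 0 ->
  (forall n, (0 < n)%N -> F.[n%:R] * (gfib a b c0 c1 n.+1)%:~R
     + G.[n%:R] * (gfib a b c0 c1 n)%:~R + H.[n%:R] = 0) ->
  [/\ F = 0, G = 0 & H = 0].
Proof.
move=> sxy pxy uxy b0 cx cy FGH.
have := uxy; rewrite /= !inE negb_or => /andP[/andP[xy x1] /andP[y1 _]].
have xy0 : x * y != 0 by rewrite pxy oppr_eq0 pnatr_eq0 -lt0n.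
have [x0 y0] : x != 0 /\ y != 0 by apply/andP; rewrite -negb_or -mulf_eq0.
have yx : (y == x) = false by rewrite eq_sym; apply/negbTE.
(* The coefficients of the bases [x], [y] and 1 after multiplying the relation by [x - y] and
   inserting Binet's formula. *)
pose Q z := if z == x then (c1%:~R - y * c0%:~R) *: (x *: F + G)
            else if z == y then - (c1%:~R - x * c0%:~R) *: (y *: F + G)
            else (x - y) *: H.
have Q0 : forall z, z \in [:: x; y; 1] -> Q z = 0.
  apply: exp_poly_indep => // [|n n0].
    by rewrite !inE !(eq_sym 0) !negb_or x0 y0 oner_eq0.
  rewrite !big_cons big_nil /Q eqxx yx eqxx !(eq_sym 1) (negbTE x1) (negbTE y1).
  have := congr1 ( *%R (x - y)) (FGH n n0).
  rewrite !mulrDr mulr0 ![(x - y) * (_ * _%:~R)]mulrCA.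
  rewrite !(gfib_binet _ _ sxy pxy) !hornerE expr1n !exprS => e.
  by rewrite -[RHS]e /=; ring.
have := Q0 x; have := Q0 y; have := Q0 1.
rewrite !inE !eqxx !orbT /Q eqxx yx eqxx !(eq_sym 1) (negbTE x1) (negbTE y1).
move=> /(_ isT)/eqP + /(_ isT)/eqP + /(_ isT)/eqP.
rewrite !scaler_eq0 oppr_eq0 subr_eq0 (negbTE xy) (negbTE cx) (negbTE cy) /=.
move=> /eqP-> /eqP eqy /eqP eqx.
(* Subtract [y *: F + G = 0] from [x *: F + G = 0]. *)
have F0 : F = 0.
  have : (x - y) *: F = 0.
    by rewrite scalerBl -(subrr 0) -{1}eqx -eqy; ring.
  by move/eqP; rewrite scaler_eq0 subr_eq0 (negbTE xy) => /eqP.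
by split=> //; move: eqx; rewrite F0 scaler0 add0r.
Qed.

Lemma gfib_sum_solution (K : numFieldType) (a b : nat) (c0 c1 : int)
    (P : {poly K}) : (0 < a)%N -> (0 < b)%N ->
  exists F G H : {poly K}, forall n : nat,
    2 * (\sum_(1 <= k < n.+1) P.[k%:R] * (gfib a b c0 c1 k.-1)%:~R) =
    F.[n%:R] * (gfib a b c0 c1 n.+1)%:~R
    + G.[n%:R] * (gfib a b c0 c1 n)%:~R + H.[n%:R].
Proof.
move=> a0 b0.
pose sh (c : K) (p : {poly K}) := p \Po ('X + c%:P).
pose L p := b%:R *: p + a%:R *: sh (-1) p - sh (-2) p.
have LB : {morph L : p q / p - q}.
  by move=> p q; rewrite /L /sh !raddfB /=; ring.
(* Since [a] and [b] are positive, this is the cast of a positive integer. *)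
have ab0 : b%:R + a%:R - 1 != 0 :> K.
  rewrite -natrD -(prednK b0) addSn -natr1 addrK pnatr_eq0 addn_eq0.
  by rewrite negb_and -lt0n -(lt0n a) a0 orbT.
have szL p : (size (L p - (b%:R + a%:R - 1) *: p)%R <= (size p).-1)%N.
  have -> : L p - (b%:R + a%:R - 1) *: p =
            a%:R *: (sh (-1) p - p) - (sh (-2) p - p).
    by rewrite /L scalerBr !(scalerDl, scalerBl) scaleNr scale1r; ring.
  rewrite (leq_trans (size_polyD _ _)) // size_polyN geq_max.
  by rewrite (leq_trans (size_scale_leq _ _)) ?size_comp_polyXaddC_sub.
have [F LF] := leading_scale_surj ab0 LB szL (2 *: P).
(* This choice cancels the terms in [s_(n+1)] when the right-hand sides at [n+1] and [n] are
   subtracted; the terms in [s_n] then give the equation for [F]. *)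
pose G := sh (-1) F - a%:R *: F.
(* Taking [- h] as the constant makes the identity hold at [n = 0], where the sum is empty. *)
pose h := F.[0] * c1%:~R + G.[0] * c0%:~R.
exists F, G, (- h)%:P; elim=> [|n IHn].
  by rewrite big_geq // mulr0 hornerC /h /=; ring.
have shE c p t : (sh c p).[t] = p.[t + c] by rewrite horner_comp !hornerE.
have e2 : n.+1%:R - 2 = n%:R - 1 :> K by rewrite -natr1; ring.
have e1 : n.+1%:R - 1 = n%:R :> K by rewrite -natr1 addrK.
have LFn : b%:R * F.[n.+1%:R] + a%:R * F.[n%:R] - F.[n%:R - 1] = 2 * P.[n.+1%:R].
  by rewrite -(hornerZ 2) -LF /L hornerD hornerN hornerD !hornerZ !shE e1 e2.
rewrite big_nat_recr // [n.+1.-1]/= mulrDr IHn !hornerC mulrA -LFn.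
rewrite gfibSS rmorphD !rmorphM /= -!pmulrn /G !hornerD !hornerN !hornerZ !shE e1.
ring.
Qed.

Theorem theorem3p2 (R : realType) (a b : nat) (c0 c1 : int)
  (ha : (0 < a)%N) (hb : (0 < b)%N) (hc : (c0, c1) <> (0, 0))
  (h1 : 2 * c1%:~R - j1 R a b * c0%:~R <> 0)
  (h2 : 2 * c1%:~R - j2 R a b * c0%:~R <> 0)
  (P : {poly R}) :
  exists! T : {poly R} * {poly R} * {poly R},
    let: (F1, G1, H1) := T in
    forall n : nat, (0 < n)%N ->
      2 * (\sum_(1 <= k < n.+1) P.[k%:R] * (gfib a b c0 c1 k.-1)%:~R) =
      F1.[n%:R] * (gfib a b c0 c1 n.+1)%:~R
      + G1.[n%:R] * (gfib a b c0 c1 n)%:~R + H1.[n%:R].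
Proof.
have [F [G [H FGH]]] := gfib_sum_solution c0 c1 P ha hb.
exists (F, G, H); split=> [n _|[[F' G'] H'] FGH']; first exact: FGH.
pose x := j1 R a b / 2; pose y := j2 R a b / 2.
have a1 : 1 <= a%:R :> R by rewrite ler1n.
have b1 : 1 <= b%:R :> R by rewrite ler1n.
set d := Num.sqrt (a%:R ^+ 2 + 4 * b%:R : R).
have d2 : d ^+ 2 = a%:R ^+ 2 + 4 * b%:R by rewrite sqr_sqrtr //; nra.
(* From [d > a >= 1] follow [x > 1] and [y < 0], which separate the bases [x], [y] and 1. *)
have ad : a%:R < d by rewrite -(@ltr_pXn2r _ 2) ?nnegrE ?sqrtr_ge0 ?d2 //; lra.
have sxy : x + y = a%:R by rewrite /x /y /j1 /j2 -/d; field.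
have pxy : x * y = - b%:R.
  have -> : x * y = (a%:R ^+ 2 - d ^+ 2) / 4 by rewrite /x /y /j1 /j2 -/d; field.
  by rewrite d2; field.
have x1 : 1 < x by rewrite /x /j1 -/d; lra.
have y0 : y < 0 by rewrite /y /j2 -/d; lra.
(* The two nonvanishing hypotheses, divided by 2. *)
have cx : c1%:~R - x * c0%:~R != 0.
  by apply/eqP => e; apply: h1; rewrite -(mulr0 2) -e /x; field.
have cy : c1%:~R - y * c0%:~R != 0.
  by apply/eqP => e; apply: h2; rewrite -(mulr0 2) -e /y; field.
have uxy : uniq [:: x; y; 1].
  by rewrite /= !inE negb_or !andbT -andbA; apply/and3P; split; apply/eqP; lra.
have [|/eqP + /eqP + /eqP] := @gfib_exp_poly_indep _ _ _ _ _ _ _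
    (F - F') (G - G') (H - H') sxy pxy uxy hb cx cy.
  move=> n n0; have /eqP := FGH' n n0; rewrite FGH -subr_eq0 => /eqP e.
  by rewrite !(hornerD, hornerN) -[RHS]e; ring.
by rewrite !subr_eq0 => /eqP-> /eqP-> /eqP->.
Qed.
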